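(* Fix any $g,h>0$, $l_0\ge1$, $\alpha\in(0,1)$, and $\rho>gh$. Let $r=\rho-gh$ and define $$f_{g,h}(v)=\sup\left\{s\in\left[0,\tfrac{r+v}{g}\right):\ m_{g,h}(s,v)<\frac{l_0}{\alpha}\right\},$$ $$m_{g,h}(s,v)=\frac{(g+h)^{v/gh}}{\left[g^{v/h+s}\,h^{v/g-s}\right]^{1/(g+h)}}\cdot\frac{B_{h/(g+h)}\left(\frac{r+v-gs}{g(g+h)},\frac{r+v+hs}{h(g+h)}\right)}{B_{h/(g+h)}\left(\frac{r}{g(g+h)},\frac{r}{h(g+h)}\right)}.$$ Then $f_{g,h}$ is an $l_0$-sub-Bernoulli uniform boundary with crossing probability $\alpha$ and range parameters $g,h$.
   Context: $B_x(a,b)=\int_0^xp^{a-1}(1-p)^{b-1}\,dp$ is the incomplete Beta function. Sub-$\psi$ condition: let $(S_t)_{t=0}^\infty$, $(V_t)_{t=0}^\infty$ be real-valued processes adapted to a filtration $(\mathcal F_t)_{t=0}^\infty$ with $S_0=V_0=0$ and $V_t\ge 0$ for all $t$. For $\psi:[0,\lambda_{\max})\to\mathbb{R}$ and $l_0\in[1,\infty)$, $(S_t)$ is $l_0$-sub-$\psi$ with variance process $(V_t)$ if for each $\lambda\in[0,\lambda_{\max})$ there is a supermartingale $(L_t(\lambda))_{t=0}^\infty$ with respect to $(\mathcal F_t)$ with $\mathbb{E}L_0(\lambda)\le l_0$ and $\exp\{\lambda S_t-\psi(\lambda)V_t\}\le L_t(\lambda)$ a.s. for all $t$. Uniform boundary: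 $u$ is an $l_0$-sub-$\psi$ uniform boundary with crossing probability $\alpha$ if $\mathbb{P}(\exists t\ge 1: S_t\ge u(V_t))\le\alpha$ for every pair $(S_t,V_t)$ such that $(S_t)$ is $l_0$-sub-$\psi$ with variance process $(V_t)$. Sub-Bernoulli with range parameters $g,h>0$ means sub-$\psi$ with $\psi(\lambda)=\psi_{B,g,h}(\lambda)=\frac1{gh}\log\left(\frac{ge^{h\lambda}+he^{-g\lambda}}{g+h}\right)$ on $[0,\infty)$. *)

(* Defs.v *)
From HB Require Import structures.
From mathcomp Require Import all_boot all_order all_algebra.
From mathcomp Require Import all_classical all_reals all_analysis.

Set Implicit Arguments.
Unset Strict Implicit.
Unset Printing Implicit Defensive.

Import Order.TTheory GRing.Theory Num.Theory.
Import numFieldNormedType.Exports.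

Local Open Scope classical_set_scope.
Local Open Scope ring_scope.

Section processes.
Context (d : measure_display) (T : measurableType d) (R : realType).
Variable P : probability T R.

Definition sub_sigma_field (G : set (set T)) : Prop :=
  sigma_algebra setT G /\ G `<=` measurable.

Definition filtration (F : nat -> set (set T)) : Prop :=
  (forall t, sub_sigma_field (F t)) /\
  (forall s t, (s <= t)%N -> F s `<=` F t).

(* Since g_sigma_algebraType G carries the sigma-algebra generated by G, this
   is measurability with respect to G itself when G is a sigma-algebra. *)
Definition G_measurable (G : set (set T)) (X : T -> R) : Prop :=
  measurable_fun [set: g_sigma_algebraType G] (X : g_sigma_algebraType G -> R).

Definition adapted (F : nat -> set (set T)) (X : nat -> T -> R) : Prop :=
  forall t, G_measurable (F t) (X t).

(* Y is a version of the conditional expectation of X given G. *)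
Definition is_cond_expectation (G : set (set T)) (X Y : T -> R) : Prop :=
  [/\ G_measurable G Y,
      P.-integrable setT (EFin \o Y) &
      forall A, G A -> (\int[P]_(w in A) (Y w)%:E = \int[P]_(w in A) (X w)%:E)%E].

(* Versions of a conditional expectation agree almost surely, so it does not
   matter which one is compared with L t. *)
Definition supermartingale (F : nat -> set (set T)) (L : nat -> T -> R) : Prop :=
  [/\ adapted F L,
      forall t, P.-integrable setT (EFin \o L t) &
      forall t, exists2 Y, is_cond_expectation (F t) (L t.+1) Y &
        {ae P, forall w, Y w <= L t w}].

(* The function psi is total, but only its values on [0, lmax[ are used. *)
Definition sub_psi (F : nat -> set (set T)) (psi : R -> R) (lmax : \bar R)
    (l0 : R) (S V : nat -> T -> R) : Prop :=
  [/\ adapted F S, adapted F V,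
      forall w, S 0%N w = 0 /\ V 0%N w = 0,
      forall t w, 0 <= V t w &
      forall lambda : R, 0 <= lambda -> (lambda%:E < lmax)%E ->
      exists L : nat -> T -> R,
        [/\ supermartingale F L,
            ('E_P[L 0%N] <= l0%:E)%E &
            forall t, {ae P, forall w,
              expR (lambda * S t w - psi lambda * V t w) <= L t w}]].

End processes.

Section boundaries.
Context (R : realType).

(* The values of P on non-measurable sets carry no meaning, so the crossing set
   is explicitly required to be an event. *)
Definition uniform_boundary (psi : R -> R) (lmax : \bar R) (l0 alpha : R)
    (u : R -> R) : Prop :=
  forall (d : measure_display) (T : measurableType d) (P : probability T R)
    (F : nat -> set (set T)) (S V : nat -> T -> R),
  filtration F -> sub_psi P F psi lmax l0 S V ->
  let crossing := [set w | exists2 t, (1 <= t)%N & u (V t w) <= S t w] in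
  measurable crossing /\ (P crossing <= alpha%:E)%E.

Definition psi_bernoulli (g h lambda : R) : R :=
  (g * h)^-1 *
  ln ((g * expR (h * lambda) + h * expR (- (g * lambda))) / (g + h)).

Definition sub_bernoulli_uniform_boundary (g h l0 alpha : R) (u : R -> R) : Prop :=
  uniform_boundary (psi_bernoulli g h) +oo%E l0 alpha u.

(* Real-valued integral: the Lebesgue integral is finite whenever
   0 < a and 0 <= x < 1. *)
Definition incomplete_beta (x a b : R) : R :=
  \int[lebesgue_measure]_(p in `[0, x]) (p `^ (a - 1) * (1 - p) `^ (b - 1)).

Definition m_mix (g h r s v : R) : R :=
  (g + h) `^ (v / (g * h)) /
    (g `^ (v / h + s) * h `^ (v / g - s)) `^ (g + h)^-1 *
  (incomplete_beta (h / (g + h))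
     ((r + v - g * s) / (g * (g + h))) ((r + v + h * s) / (h * (g + h))) /
   incomplete_beta (h / (g + h)) (r / (g * (g + h))) (r / (h * (g + h)))).

(* For g > 0 the set is bounded above by (r + v) / g, and for r > 0, v >= 0 and
   l0 / alpha > 1 it contains s = 0, so the real-valued sup is the true one. *)
Definition f_mix (g h r l0 alpha v : R) : R :=
  sup [set s : R | [/\ 0 <= s, s < (r + v) / g & m_mix g h r s v < l0 / alpha]].

End boundaries.

(* Main.v *)
(* With q = h e^(-g l) / (g e^(h l) + h e^(-g l)), the factor exp(l s - psi(l) v)
   becomes a constant times q^((v - g s) / (g (g + h))) (1 - q)^((v + h s) / (h (g + h))),
   and l >= 0 becomes 0 < q <= h / (g + h).  Hence m(s, v) is the mixture of these
   factors under a truncated beta law of q.  The mixture increases with s, is at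
   most 1 at s = 0, is infinite for s >= (r + v) / g, and is convex in s; therefore
   s >= f(v) exactly when the mixture at (s, v) is at least l0 / alpha.
   The supermartingales L(l) need not be jointly measurable in l, so they are never
   mixed.  For each l, optional stopping of L(l) at the first passage of the mixture
   bounds the expectation of exp(l S - psi(l) V) there by l0; only these jointly
   measurable factors are integrated over q, by Tonelli's theorem, and Markov's
   inequality at the first passage time concludes. *)
Require Import Defs.
From HB Require Import structures.
From mathcomp Require Import all_boot all_order all_algebra.
From mathcomp Require Import all_classical all_reals all_analysis.
From mathcomp Require Import measurable_realfun ring lra.

Set Implicit Arguments.
Unset Strict Implicit.
Unset Printing Implicit Defensive.

Import Order.TTheory GRing.Theory Num.Theory.
Import numFieldNormedType.Exports.

Local Open Scope classical_set_scope.
Local Open Scope ring_scope.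

(** * Optional stopping at a first passage time *)

(** Deleting a null set that contains the exceptional points changes neither integral, and off it
    the inequality is pointwise. *)
Lemma ae_le_integral d (T : measurableType d) (R : realType)
    (mu : {measure set T -> \bar R}) (D : set T) (f g : T -> \bar R) :
  measurable D -> mu.-integrable D f -> mu.-integrable D g ->
  {ae mu, forall x, D x -> (f x <= g x)%E} ->
  (\int[mu]_(x in D) f x <= \int[mu]_(x in D) g x)%E.
Proof.
move=> mD intf intg [N [mN N0 subN]].
rewrite (negligible_integral mN mD intf N0) (negligible_integral mN mD intg N0).
have mDN : measurable (D `\` N) by exact: measurableD.
apply: le_integral => //.
- by apply: integrableS intf => // x [].
- by apply: integrableS intg => // x [].
- move=> x /set_mem[Dx Nx]; apply: contrapT => nfg; apply: Nx; apply: subN.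
  by move/(_ Dx).
Qed.

Section probability.
Context {d : measure_display} {T : measurableType d} {R : realType}.
Variables (P : probability T R) (F : nat -> set (set T)).
Hypothesis filtF : filtration F.

Lemma filtration_measurable t A : F t A -> measurable A.
Proof. by case: filtF => + _ => /(_ t)[_ sub] /sub. Qed.

Lemma filtrationT t : F t setT.
Proof.
have [[[F0 FC _] _] _] := (filtF.1 t, I).
by rewrite -[setT]setD0; exact: FC.
Qed.

Lemma filtrationD t A B : F t A -> F t B -> F t (A `\` B).
Proof.
move=> FA FB; have [sF _] := filtF.1 t.
have -> : F t = @measurable _ (g_sigma_algebraType (F t)).
  by rewrite /measurable /= sigma_algebra_id.
by apply: measurableD; rewrite /measurable /= sigma_algebra_id.
Qed.

Lemma adapted_measurable (X : nat -> T -> R) t :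
  adapted F X -> measurable_fun setT (X t).
Proof.
move=> /(_ t) mX _ B mB; apply: (@filtration_measurable t).
have [sF _] := filtF.1 t.
by have := mX measurableT B mB; rewrite /measurable /= sigma_algebra_id.
Qed.

(** [E 0] is left out because crossings only count from time 1 on. *)
Fixpoint survival (E : nat -> set T) (n : nat) : set T :=
  if n is n'.+1 then survival E n' `\` E n else setT.

(** Shifted index: on [first_hit E n] the first passage happens at time [n.+1]. *)
Definition first_hit (E : nat -> set T) (n : nat) : set T :=
  survival E n `&` E n.+1.

Lemma survivalE E n : survival E n = first_hit E n `|` survival E n.+1.
Proof.
by rewrite /first_hit /= -setDD setUC setDUK // => x [].
Qed.

Lemma disj_first_hit E n : [disjoint first_hit E n & survival E n.+1]%classic.
Proof.
by apply/disj_set2P; rewrite -subset0 => x [[_ Ex] [_ /(_ Ex)]].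
Qed.

Lemma survivalC E n :
  ~` survival E n = \bigcup_(t in [set t | (t < n)%N]) E t.+1.
Proof.
elim: n => [|n IH].
  by rewrite /= setCT; apply/seteqP; split=> x // [].
rewrite /= setCD setUC IH; apply/seteqP; split=> x /=.
  case=> [Ex|[t /= tn Ex]]; first by exists n => /=.
  by exists t => //=; exact: ltnW.
move=> [t /=]; rewrite ltnS leq_eqVlt => /orP[/eqP->|tn] Ex; first by left.
by right; exists t.
Qed.

Variable E : nat -> set T.
Hypothesis FE : forall t, F t (E t).

Lemma survival_filtration t : F t (survival E t).
Proof.
elim: t => [|t IH]; first exact: filtrationT.
by apply: filtrationD => //; apply: (filtF.2 t) => //; exact: IH.
Qed.

Lemma measurable_survival t : measurable (survival E t).
Proof. exact: filtration_measurable (survival_filtration t). Qed.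

Lemma measurable_first_hit t : measurable (first_hit E t).
Proof.
apply: measurableI; first exact: measurable_survival.
exact: filtration_measurable (FE t.+1).
Qed.

(** Survival up to time [t] is an event of [F t], so on it [L t.+1] may be replaced by its
    conditional expectation, which is almost surely at most [L t]. *)
Lemma supermartingale_le_survival (L : nat -> T -> R) t :
  supermartingale P F L ->
  (\int[P]_(w in survival E t) (L t.+1 w)%:E <=
   \int[P]_(w in survival E t) (L t w)%:E)%E.
Proof.
case=> adL intL condL; have [Y [_ intY eqY] YL] := condL t.
have FB := survival_filtration t.
rewrite -(eqY _ FB); apply: ae_le_integral.
- exact: measurable_survival.
- by apply: integrableS intY => //; exact: measurable_survival.
- by apply: integrableS (intL t) => //; exact: measurable_survival.
- by apply: filterS YL => w /= YL _; rewrite lee_fin.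
Qed.

(* Optional stopping at the first [t >= 1] such that [E t] occurs, capped at [n]. *)
Lemma supermartingale_first_hit (L : nat -> T -> R) n :
  supermartingale P F L ->
  (\sum_(t < n) \int[P]_(w in first_hit E t) (L t.+1 w)%:E +
   \int[P]_(w in survival E n) (L n w)%:E <= \int[P]_w (L 0%N w)%:E)%E.
Proof.
move=> sL; elim: n => [|n IH]; first by rewrite big_ord0 add0e.
apply: le_trans IH; rewrite big_ord_recr -addeA; apply: leeD => //.
apply: le_trans (supermartingale_le_survival n sL).
have [_ intL _] := sL.
rewrite [in leRHS](survivalE E n) integral_setU //.
- exact: measurable_first_hit.
- exact: measurable_survival n.+1.
- apply/(measurable_funS measurableT) => //.
  exact: measurable_int (intL n.+1).
- exact: disj_first_hit.
Qed.

(** Passing from [L] to the smaller [Z] matters because [Z] can later be chosen jointly measurable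
    in a parameter. The survival term is dropped: [L n] is almost surely nonnegative, as it
    dominates [Z n]. *)
Lemma dominated_first_hit (L Z : nat -> T -> R) n :
  supermartingale P F L ->
  (forall t, measurable_fun setT (Z t)) -> (forall t w, 0 <= Z t w) ->
  (forall t, {ae P, forall w, Z t w <= L t w}) ->
  (\sum_(t < n) \int[P]_(w in first_hit E t) (Z t.+1 w)%:E
   <= \int[P]_w (L 0%N w)%:E)%E.
Proof.
move=> sL mZ Z0 ZL; have [_ intL _] := sL.
apply: le_trans (supermartingale_first_hit n sL).
have ge0L : (0 <= \int[P]_(w in survival E n) (L n w)%:E)%E.
  rewrite -(integral0 P (survival E n)); apply: ae_le_integral.
  - exact: measurable_survival.
  - apply: integrable0.
  - by apply: integrableS (intL n) => //; exact: measurable_survival.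
  - by apply: filterS (ZL n) => w ZLw _; rewrite lee_fin (le_trans (Z0 n w)).
rewrite -[leLHS]adde0; apply: leeD => //; apply: lee_sum => t _.
have mA := measurable_first_hit t.
have intLA : P.-integrable (first_hit E t) (EFin \o L t.+1).
  by apply: integrableS (intL t.+1).
have mZA : measurable_fun (first_hit E t) (EFin \o Z t.+1).
  by apply/measurable_EFinP; exact: measurable_funTS.
apply: ae_le_integral => //; last first.
  by apply: filterS (ZL t.+1) => w /= ZLw _; rewrite lee_fin.
(* [Z] inherits integrability from [L], since [0 <= Z <= L] almost surely. *)
apply/integrableP; split=> //.
have /integrableP[mL] := intLA; apply: le_lt_trans.
apply: ae_ge0_le_integral => //.
- by apply: measurableT_comp.
- by apply: measurableT_comp.
- apply: filterS (ZL t.+1) => w /= ZLw _; rewrite lee_fin.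
  by rewrite ger0_norm // (le_trans ZLw) // ler_norm.
Qed.

Lemma first_hit_exit n :
  P (~` survival E n) = (\sum_(t < n) P (first_hit E t))%E.
Proof.
elim: n => [|n IH]; first by rewrite big_ord0 /= setCT measure0.
rewrite big_ord_recr -IH.
transitivity (P (~` survival E n `|` first_hit E n)).
  congr (P _); rewrite /first_hit /= setCD; apply/seteqP; split=> w.
    by case: (pselect (survival E n w)) => ? [] *; [|right|left|left].
  by case=> [|[]]; [left|right].
rewrite measureU //.
- by apply: measurableC; exact: measurable_survival.
- exact: measurable_first_hit.
- by apply/seteqP; split=> // w [nBw [/nBw]].
Qed.

(** * Mixing over a parameter *)

Section mixture.
Context {d' : measure_display} {Q : measurableType d'}.
Variables (mu : {sigma_finite_measure set Q -> \bar R}).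
Variables (Z : nat -> Q * T -> R) (c : Q -> R).
Hypothesis mZ : forall t, measurable_fun setT (Z t).
Hypothesis Z0 : forall t x, 0 <= Z t x.
Hypothesis mc : measurable_fun setT c.

(** Everything is nonnegative, so Tonelli's theorem exchanges the two integrals and the bound for
    each [q] can be integrated. *)
Lemma mixture_first_hit n :
  (forall q, (\sum_(t < n) \int[P]_(w in first_hit E t) (Z t.+1 (q, w))%:E
     <= (c q)%:E)%E) ->
  (\sum_(t < n) \int[P]_(w in first_hit E t) \int[mu]_q (Z t.+1 (q, w))%:E
   <= \int[mu]_q (c q)%:E)%E.
Proof.
move=> Zc.
(* The hitting event becomes an indicator in the integrand, so that both integrals run over whole
   spaces. *)
pose Z1 t (x : Q * T) := (Z t.+1 x * \1_(first_hit E t) x.2)%:E.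
have mZ1 t : measurable_fun setT (Z1 t).
  apply/measurable_EFinP/measurable_funM => //.
  apply: measurableT_comp => //.
  by apply: measurable_indic; exact: measurable_first_hit.
have Z10 t x : (0 <= Z1 t x)%E.
  by rewrite lee_fin mulr_ge0.
have inE1 t q : (\int[P]_(w in first_hit E t) (Z t.+1 (q, w))%:E =
    \int[P]_w Z1 t (q, w))%E.
  by rewrite integral_mkcond epatch_indic.
have swap t : (\int[P]_(w in first_hit E t) \int[mu]_q (Z t.+1 (q, w))%:E =
    \int[mu]_q \int[P]_w Z1 t (q, w))%E.
  rewrite fubini_tonelli // integral_mkcond; apply: eq_integral => w _.
  rewrite patchE /Z1; case: ifPn => wA.
    by apply: eq_integral => q _; rewrite indicE wA mulr1.
  rewrite -[LHS](integral0 mu setT); apply: eq_integral => q _.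
  by rewrite indicE (negbTE wA) mulr0.
under eq_bigr do rewrite swap.
rewrite -ge0_integral_sum //; last 2 first.
- by move=> t; exact: (measurable_fun_fubini_tonelli_F (Z1 t)).
- by move=> t q _; apply: integral_ge0.
apply: ge0_le_integral => //.
- by move=> q _; apply: sume_ge0 => t _; apply: integral_ge0.
- apply: emeasurable_sum => t.
  exact: (measurable_fun_fubini_tonelli_F (Z1 t)).
- by apply/measurable_EFinP.
- by move=> q _; apply: le_trans (Zc q); under eq_bigr do rewrite -inE1.
Qed.

End mixture.

(** Markov's inequality on each disjoint event [first_hit E t], where [M t.+1] is at least [k],
    bounds the probability of passage by time [n]; continuity from below lets [n] grow. *)
Lemma first_passage_prob (M : nat -> T -> \bar R) (k c : R) :
  0 < k -> (forall t, measurable_fun setT (M t)) ->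
  (forall t w, 0 <= M t w)%E ->
  (forall t w, E t w -> k%:E <= M t w)%E ->
  (forall n, \sum_(t < n) \int[P]_(w in first_hit E t) M t.+1 w <= c%:E)%E ->
  (P (\bigcup_t E t.+1) <= (c / k)%:E)%E.
Proof.
move=> k0 mM M0 EM Mc.
have mB n : measurable (~` survival E n).
  by apply: measurableC; exact: measurable_survival.
have Pn n : (P (~` survival E n) <= (c / k)%:E)%E.
  rewrite mulrC EFinM lee_pdivlMl // first_hit_exit.
  rewrite ge0_sume_distrr //.
  apply: le_trans (Mc n); apply: lee_sum => t _.
  have mA := measurable_first_hit t.
  rewrite -(integral_cst P mA); apply: ge0_le_integral => //.
  - by move=> w _; rewrite lee_fin ltW.
  - exact: measurable_funTS.
  - by move=> w [_ /EM].
have -> : \bigcup_t E t.+1 = \bigcup_n ~` survival E n.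
  apply/seteqP; split=> w.
    by move=> [t _ Ew]; exists t.+1 => //; rewrite survivalC; exists t => /=.
  by move=> [n _]; rewrite survivalC => -[t _ Ew]; exists t.
have ndB : nondecreasing_seq (fun n => ~` survival E n).
  apply/nondecreasing_seqP => n; apply/subsetPset.
  by apply: subsetC => w [].
have cvgB := nondecreasing_cvg_mu mB (bigcup_measurable (fun n _ => mB n)) ndB.
by apply: (cvge_le _ (cvgB _ P)); exact: nearW.
Qed.

End probability.

(** * Truncated beta integrals *)

Section beta_integrals.
Context {R : realType}.
Implicit Types (a b c x y q e : R) (f G : R -> R).
Notation leb := (@lebesgue_measure R).

(** The lower limit stays positive because the powers integrated below may be singular at 0. *)
Lemma FTC2_pos f G e x : 0 < e -> e < x ->
  (forall q, 0 < q -> is_derive q 1 G (f q)) ->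
  (forall q, 0 < q -> {for q, continuous f}) ->
  (\int[leb]_(q in `[e, x]) (f q)%:E = (G x - G e)%:E)%E.
Proof.
move=> e0 ex dG cf.
have x0 := lt_trans e0 ex.
have cG q : 0 < q -> {for q, continuous G}.
  move=> q0; apply: differentiable_continuous.
  by apply/derivable1_diffP; have [] := dG q q0.
rewrite EFinB; apply: continuous_FTC2 => //.
- apply: continuous_in_subspaceT => q /[!inE]/=; rewrite in_itv/= => /andP[eq _].
  exact/cf/(lt_le_trans e0).
- split.
  + by move=> q; rewrite in_itv/= => /andP[eq _]; have [] := dG _ (lt_trans e0 eq).
  + exact/cvg_at_right_filter/cG.
  + exact/cvg_at_left_filter/cG.
- move=> q; rewrite in_itv/= => /andP[eq _].
  by rewrite derive1E; have [_ ->] := dG _ (lt_trans e0 eq).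
Qed.

Lemma continuous_powR_pos c q : 0 < q -> {for q, continuous (@powR R ^~ c)}.
Proof.
move=> q0; apply: differentiable_continuous; apply/derivable1_diffP.
by apply: derivable_powR; rewrite in_itv/= q0.
Qed.

Lemma integral_powRN1_oo x : 0 < x ->
  (\int[leb]_(q in `]0%R, x]) (q `^ (-1))%:E = +oo)%E.
Proof.
move=> x0; apply/eqyP => B B0.
(* From this lower limit up to [x] the logarithmic integral is exactly [B]. *)
have e0 : 0 < x * expR (- B) by rewrite mulr_gt0 // expR_gt0.
have ex : x * expR (- B) < x.
  by rewrite gtr_pMr // -[ltRHS]expR0 ltr_expR oppr_lt0.
have -> : B%:E = (\int[leb]_(q in `[(x * expR (- B))%R, x]) (q `^ (-1))%:E)%E.
  have dln q : 0 < q -> is_derive q 1 (@ln R) (q `^ (-1)).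
    by move=> q0; rewrite powR_inv1 ?ltW //; exact: is_derive1_ln.
  rewrite (FTC2_pos e0 ex dln (@continuous_powR_pos _)).
  by rewrite lnM ?posrE ?expR_gt0 // expRK; congr (_%:E); ring.
apply: ge0_subset_integral => //.
- by apply/measurable_EFinP; apply: measurable_funTS; exact: measurable_powR.
- by move=> q _; rewrite lee_fin powR_ge0.
- move=> q /=; rewrite !in_itv/= => /andP[eq ->].
  by rewrite (lt_le_trans e0 eq).
Qed.

Lemma integral_powR_lty a x : 0 < a -> 0 < x ->
  (\int[leb]_(q in `]0%R, x]) (q `^ (a - 1))%:E < +oo)%E.
Proof.
move=> a0 x0.
pose A n := `[(x / n.+2%:R), x]%classic.
have An n : 0 < x / n.+2%:R by rewrite divr_gt0.
have Ax n : x / n.+2%:R < x.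
  by rewrite ltr_pdivrMr ?ltr_pMr // ltr1n.
have -> : `]0, x]%classic = \bigcup_n A n.
  apply/seteqP; split=> q /=.
    rewrite in_itv/= => /andP[q0 qx].
    exists (Num.truncn (x / q)) => //; rewrite /A /= in_itv/= qx andbT.
    rewrite ler_pdivrMr // mulrC -ler_pdivrMr //.
    rewrite ltW // (lt_trans (truncnS_gt _)) // ltr_nat //.
  by move=> [n _]; rewrite /A /= !in_itv/= => /andP[nq ->]; rewrite (lt_le_trans _ nq).
have ndA : nondecreasing_seq A.
  apply/nondecreasing_seqP => n; apply/subsetPset => q.
  rewrite /A /= !in_itv/= => /andP[nq ->]; rewrite andbT; apply: le_trans nq.
  by rewrite ler_pM2l // lef_pV2 ?posrE // ler_nat.
have mA n : measurable (A n) by exact: measurable_itv.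
have mf n : measurable_fun (A n) (fun q => (q `^ (a - 1))%:E).
  by apply/measurable_EFinP; apply: measurable_funTS; exact: measurable_powR.
have f0 n q : A n q -> (0 <= (q `^ (a - 1))%:E)%E by rewrite lee_fin powR_ge0.
have cvgA := ge0_nondecreasing_set_cvg_integral (mu := leb) ndA mA mf f0.
apply: (@le_lt_trans _ _ (a^-1 * x `^ a)%:E); last exact: ltry.
apply: (cvge_le _ cvgA); apply: nearW => n.
have dp q : 0 < q -> is_derive q 1 (fun q => a^-1 * q `^ a) (q `^ (a - 1)).
  move=> q0; have := is_deriveZ a^-1 (is_derive1_powR a q0).
  by rewrite /GRing.scale/= mulrA mulVf ?mul1r ?gt_eqF.
rewrite (FTC2_pos (An n) (Ax n) dp (@continuous_powR_pos _)).
by rewrite lee_fin gerBl mulr_ge0 ?powR_ge0 // invr_ge0 ltW.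
Qed.

(** Absolute values make the bounds hold for exponents of either sign. *)
Lemma powR_bounds y q c : 0 < y -> y <= q -> q <= 1 ->
  expR (- (`|c| * `|ln y|)) <= q `^ c <= expR (`|c| * `|ln y|).
Proof.
move=> y0 yq q1; have q0 := lt_le_trans y0 yq.
rewrite {1 2}/powR gt_eqF // !ler_expR -ler_norml normrM.
rewrite ler_wpM2l // !ler0_norm ?ln_le0 ?(le_trans yq) //.
by rewrite lerN2 ler_ln.
Qed.

Definition beta_density a b q := q `^ (a - 1) * (1 - q) `^ (b - 1).

Lemma beta_density_ge0 a b q : 0 <= beta_density a b q.
Proof. by rewrite mulr_ge0 ?powR_ge0. Qed.

Lemma measurable_beta_density a b : measurable_fun setT (beta_density a b).
Proof.
apply: measurable_funM; first exact: measurable_powR.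
apply: (measurableT_comp (measurable_powR _)).
exact: measurable_funB.
Qed.

Variables (x : R).
Hypotheses (x0 : 0 < x) (x1 : x < 1).

Let mbeta a b (D : set R) : measurable_fun D (EFin \o beta_density a b).
Proof.
by apply/measurable_EFinP/measurable_funTS; exact: measurable_beta_density.
Qed.

Let onem_bounds b q : q <= x -> 0 <= q ->
  let K := `|b - 1| * `|ln (1 - x)| in
  expR (- K) <= (1 - q) `^ (b - 1) <= expR K.
Proof.
move=> qx q0; apply: powR_bounds; first by rewrite subr_gt0.
- by rewrite lerB.
- by rewrite gerBl.
Qed.

(** Only the singularity at 0 matters: as [x < 1], the factor in [1 - q] is bounded on []0, x]]
    whatever [b] is. *)
Lemma integral_beta_lty a b : 0 < a ->
  (\int[leb]_(q in `]0%R, x]) (beta_density a b q)%:E < +oo)%E.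
Proof.
move=> a0; pose K := `|b - 1| * `|ln (1 - x)|.
have mp : measurable_fun (`]0, x] : set R) (fun q => (q `^ (a - 1))%:E).
  by apply/measurable_EFinP; apply: measurable_funTS; exact: measurable_powR.
apply: (@le_lt_trans _ _
  (\int[leb]_(q in `]0%R, x]) ((expR K)%:E * (q `^ (a - 1))%:E))%E).
  apply: ge0_le_integral => //.
  - by move=> q _; rewrite lee_fin beta_density_ge0.
  - exact: mbeta.
  - exact: measurable_funeM.
  - move=> q /=; rewrite in_itv/= => /andP[q0 qx].
    rewrite -EFinM lee_fin /beta_density mulrC ler_wpM2r ?powR_ge0 //.
    by have /andP[] := onem_bounds b qx (ltW q0).
rewrite ge0_integralZl_EFin //.
- by rewrite lte_mul_pinfty // ?lee_fin ?expR_ge0 // integral_powR_lty.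
- by move=> q _; rewrite lee_fin powR_ge0.
Qed.

(** The factor in [1 - q] is bounded below by a positive constant, which leaves the divergent
    integral of [1 / q]. *)
Lemma integral_beta0_oo b :
  (\int[leb]_(q in `]0%R, x]) (beta_density 0 b q)%:E = +oo)%E.
Proof.
pose K := `|b - 1| * `|ln (1 - x)|.
have mp : measurable_fun (`]0, x] : set R) (fun q => (q `^ (-1))%:E).
  by apply/measurable_EFinP; apply: measurable_funTS; exact: measurable_powR.
apply/eqP; rewrite -leye_eq.
apply: (@le_trans _ _
  (\int[leb]_(q in `]0%R, x]) ((expR (- K))%:E * (q `^ (-1))%:E))%E).
  rewrite ge0_integralZl_EFin ?expR_ge0 //.
  - by rewrite integral_powRN1_oo // gt0_muley // lte_fin expR_gt0.
  - by move=> q _; rewrite lee_fin powR_ge0.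
apply: ge0_le_integral => //.
- by move=> q _; rewrite -EFinM lee_fin mulr_ge0 ?expR_ge0 ?powR_ge0.
- exact: measurable_funeM.
- exact: mbeta.
- move=> q /=; rewrite in_itv/= => /andP[q0 qx].
  rewrite -EFinM lee_fin /beta_density sub0r mulrC ler_wpM2l ?powR_ge0 //.
  by have /andP[] := onem_bounds b qx (ltW q0).
Qed.

Lemma integral_beta_gt0 a b :
  (0 < \int[leb]_(q in `]0%R, x]) (beta_density a b q)%:E)%E.
Proof.
(* A lower bound for the density on [[x / 2, x]], an interval of positive length away from both 0
   and 1. *)
pose c := expR (- (`|a - 1| * `|ln (x / 2)|)) *
          expR (- (`|b - 1| * `|ln (1 - x)|)).
have x2 : 0 < x / 2 by rewrite divr_gt0.
apply: (@lt_le_trans _ _ (\int[leb]_(q in `[(x / 2)%R, x]) c%:E)%E).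
  rewrite integral_cst //= lebesgue_measure_itv/= lte_fin.
  rewrite ifT; last by rewrite ltr_pdivrMr // ltr_pMr // ltr1n.
  by rewrite -EFinB -EFinM lte_fin !mulr_gt0 ?expR_gt0 //; lra.
apply: (@le_trans _ _
  (\int[leb]_(q in `[(x / 2)%R, x]) (beta_density a b q)%:E)%E).
  apply: ge0_le_integral => //.
  - by move=> q _; rewrite lee_fin mulr_ge0 ?expR_ge0.
  - exact: mbeta.
  - move=> q /=; rewrite in_itv/= => /andP[qx2 qx].
    have q0 := lt_le_trans x2 qx2.
    have /andP[H1 _] := onem_bounds b qx (ltW q0).
    have /andP[H2 _] := powR_bounds (a - 1) x2 qx2 (ltW (le_lt_trans qx x1)).
    by rewrite lee_fin ler_pM ?expR_ge0.
apply: ge0_subset_integral => //.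
- exact: mbeta.
- by move=> q _; rewrite lee_fin beta_density_ge0.
- move=> q /=; rewrite !in_itv/= => /andP[eq ->].
  by rewrite (lt_le_trans x2 eq).
Qed.

(** For [0 < a] the integral is finite, so [fine] loses no information. Removing the null endpoint 0
    leaves only positive [q]. *)
Lemma EFin_incomplete_beta a b : 0 < a ->
  ((incomplete_beta x a b)%:E =
   \int[leb]_(q in `]0%R, x]) (beta_density a b q)%:E)%E.
Proof.
move=> a0; rewrite integral_itv_obnd_cbnd; last exact: mbeta.
rewrite /incomplete_beta /Rintegral fineK // -integral_itv_obnd_cbnd.
  rewrite ge0_fin_numE; first exact: integral_beta_lty.
  by apply: integral_ge0 => q _; rewrite lee_fin beta_density_ge0.
exact: mbeta.
Qed.

Lemma incomplete_beta_gt0 a b : 0 < a -> 0 < incomplete_beta x a b.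
Proof.
by move=> a0; rewrite -lte_fin EFin_incomplete_beta // integral_beta_gt0.
Qed.

End beta_integrals.

(** * The Bernoulli mixture and its boundary *)

Section bernoulli_mixture.
Context {R : realType}.
Variables (g h : R).
Hypotheses (g0 : 0 < g) (h0 : 0 < h).
Notation leb := (@lebesgue_measure R).
Let x0 := h / (g + h).
Let gh0 : 0 < g + h. Proof. exact: addr_gt0. Qed.
Let x0_gt0 : 0 < x0. Proof. exact: divr_gt0. Qed.
Let x0_lt1 : x0 < 1. Proof. by rewrite ltr_pdivrMr // mul1r ltrDr. Qed.

(* The solution [l] of
   [q = h * expR (- (g * l)) / (g * expR (h * l) + h * expR (- (g * l)))]. *)
Definition tilt q := (ln h + ln (1 - q) - ln g - ln q) / (g + h).

(** The condition [q <= x0] amounts to [g * q <= h * (1 - q)]. Truncating the beta law at [x0] thus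
    keeps exactly the parameters at which the sub-Bernoulli condition speaks. *)
Lemma tilt_ge0 q : 0 < q -> q <= x0 -> 0 <= tilt q.
Proof.
move=> q0 qx; have q1 : 0 < 1 - q by rewrite subr_gt0 (le_lt_trans qx).
rewrite /tilt divr_ge0 ?(ltW gh0) // -addrA -opprD -!lnM ?posrE // subr_ge0.
rewrite ler_ln ?posrE ?mulr_gt0 //.
by move: qx; rewrite ler_pdivlMr // => qx; lra.
Qed.

Lemma measurable_tilt : measurable_fun setT tilt.
Proof.
apply: measurable_funM => //; apply: measurable_funB; last exact: measurable_ln.
apply: measurable_funB => //; apply: measurable_funD => //.
apply: (measurableT_comp (@measurable_ln R)); exact: measurable_funB.
Qed.

Lemma measurable_psi_bernoulli : measurable_fun setT (psi_bernoulli g h).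
Proof.
apply: measurable_funM => //; apply: (measurableT_comp (@measurable_ln R)).
apply: measurable_funM => //; apply: measurable_funD; apply: measurable_funM => //.
- by apply: (measurableT_comp (@measurable_expR R)); exact: measurable_funM.
- apply: (measurableT_comp (@measurable_expR R)).
  by apply: measurableT_comp => //; exact: measurable_funM.
Qed.

(** Bounding both exponentials below by their tangents at 0 cancels the linear terms and leaves
    [g + h]. *)
Lemma psi_bernoulli_ge0 l : 0 <= psi_bernoulli g h l.
Proof.
rewrite mulr_ge0 ?invr_ge0 ?(mulr_ge0 (ltW g0) (ltW h0)) // ln_ge0 //.
rewrite ler_pdivlMr // mul1r.
have := expR_ge1Dx (h * l); have := expR_ge1Dx (- (g * l)).
move=> /(ler_wpM2l (ltW h0)) H1 /(ler_wpM2l (ltW g0)) H2.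
by nra.
Qed.

(** By the choice of [tilt], the sum inside the logarithm equals its second term divided by [q]. *)
Lemma psi_bernoulli_tilt q : 0 < q -> q < 1 ->
  psi_bernoulli g h (tilt q) =
  (g * h)^-1 * (ln h - g * tilt q - ln q - ln (g + h)).
Proof.
move=> q0 q1; congr (_ * _).
have q1' : 0 < 1 - q by rewrite subr_gt0.
have gt : (g + h) * tilt q = ln h + ln (1 - q) - ln g - ln q.
  by rewrite /tilt mulrC divfK ?gt_eqF.
have E1 : expR (h * tilt q) = expR (- (g * tilt q)) * (h * (1 - q) / (g * q)).
  have -> : h * tilt q = - (g * tilt q) + (g + h) * tilt q by ring.
  rewrite expRD gt; congr (_ * _).
  rewrite -addrA -opprD -!lnM ?posrE // -ln_div ?posrE ?mulr_gt0 //.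
  by rewrite lnK // posrE divr_gt0 ?mulr_gt0.
have -> : (g * expR (h * tilt q) + h * expR (- (g * tilt q))) / (g + h) =
    h * expR (- (g * tilt q)) / (q * (g + h)).
  by rewrite E1; field; rewrite !gt_eqF.
rewrite ln_div ?posrE ?mulr_gt0 ?expR_gt0 // !lnM ?posrE ?expR_gt0 // expRK.
by ring.
Qed.

Definition mix_density r s v q :=
  beta_density (r / (g * (g + h))) (r / (h * (g + h))) q *
  expR (tilt q * s - psi_bernoulli g h (tilt q) * v).

(** The part of the exponential factor that is free of [q]. *)
Definition mix_const s v :=
  (g + h) `^ (v / (g * h)) / (g `^ (v / h + s) * h `^ (v / g - s)) `^ (g + h)^-1.

Lemma mix_const_gt0 s v : 0 < mix_const s v.
Proof. by rewrite divr_gt0 ?powR_gt0 ?mulr_gt0 ?powR_gt0. Qed.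

(** Conjugacy: the exponential factor is a product of powers of [q] and [1 - q], so it only shifts
    the beta parameters. Written as exponentials of logarithms, both sides have the same
    exponent. *)
Lemma mix_densityE r s v q : 0 < q -> q < 1 ->
  mix_density r s v q = mix_const s v *
    beta_density ((r + v - g * s) / (g * (g + h)))
                 ((r + v + h * s) / (h * (g + h))) q.
Proof.
move=> q0 q1; have q1' : 0 < 1 - q by rewrite subr_gt0.
rewrite /mix_density /mix_const /beta_density psi_bernoulli_tilt //.
rewrite powRM ?powR_ge0 // -!powRrM.
rewrite /powR !gt_eqF // -!expRD -expRN -!expRD; congr expR.
by rewrite /tilt; field; rewrite !gt_eqF.
Qed.

Lemma measurable_mix_density d (T : measurableType d) r (X Y Z : T -> R) :
  measurable_fun setT X -> measurable_fun setT Y -> measurable_fun setT Z ->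
  measurable_fun setT (fun x => mix_density r (X x) (Y x) (Z x)).
Proof.
move=> mX mY mZ; apply: measurable_funM.
  exact: (measurableT_comp (measurable_beta_density _ _)).
have mt := measurableT_comp measurable_tilt mZ.
apply: (measurableT_comp (@measurable_expR R)); apply: measurable_funB.
  exact: measurable_funM.
apply: measurable_funM => //.
exact: (measurableT_comp measurable_psi_bernoulli).
Qed.

Lemma mix_density_ge0 r s v q : 0 <= mix_density r s v q.
Proof. by rewrite mulr_ge0 ?beta_density_ge0 ?expR_ge0. Qed.

(** Extended-valued, because it is infinite from [s = (r + v) / g] on, and not divided by the mass
    of the beta weight. *)
Definition mixture r s v : \bar R :=
  (\int[leb]_(q in `]0%R, x0]) (mix_density r s v q)%:E)%E.

Let mmd r s v (D : set R) : measurable_fun D (EFin \o mix_density r s v).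
Proof.
apply/measurable_EFinP/measurable_funTS.
exact: (@measurable_mix_density _ _ r (cst s) (cst v) id).
Qed.

Lemma mixture_ge0 r s v : (0 <= mixture r s v)%E.
Proof. by apply: integral_ge0 => q _; rewrite lee_fin mix_density_ge0. Qed.

Lemma mixture_indic r s v :
  mixture r s v =
  (\int[leb]_q (mix_density r s v q * \1_(`]0%R, x0]%classic) q)%:E)%E.
Proof. by rewrite /mixture integral_mkcond epatch_indic. Qed.

Lemma measurable_mixture r :
  measurable_fun setT (fun x : R * R => mixture r x.1 x.2).
Proof.
pose f (x : R * R * R) :=
  (mix_density r x.1.1 x.1.2 x.2 * \1_(`]0%R, x0]%classic) x.2)%:E.
under eq_fun do rewrite mixture_indic.
apply: (measurable_fun_fubini_tonelli_F (m2 := leb) f).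
- apply/measurable_EFinP; apply: measurable_funM.
    by apply: measurable_mix_density => //; apply: measurableT_comp.
  by apply: measurableT_comp => //; apply: measurable_indic.
- by move=> x; rewrite lee_fin mulr_ge0 ?mix_density_ge0.
Qed.

(** The tangent at the convex combination [c] lies below the exponential at [a] and at [b], and its
    weighted mean there is [expR c]. *)
Lemma expR_convex (t a b : R) : 0 <= t <= 1 ->
  expR ((1 - t) * a + t * b) <= (1 - t) * expR a + t * expR b.
Proof.
move=> /andP[t0 t1]; set c := (1 - t) * a + t * b.
have tangent y : expR c * (1 + (y - c)) <= expR y.
  have -> : expR y = expR c * expR (y - c) by rewrite -expRD; congr expR; ring.
  rewrite ler_wpM2l ?expR_ge0 //.
  exact: expR_ge1Dx.
have -> : expR c = (1 - t) * (expR c * (1 + (a - c))) +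
                  t * (expR c * (1 + (b - c))) by rewrite /c; ring.
by rewrite lerD // ler_wpM2l // subr_ge0.
Qed.

Variable r : R.
Hypothesis r0 : 0 < r.
Let W := incomplete_beta x0 (r / (g * (g + h))) (r / (h * (g + h))).
Let a0_gt0 : 0 < r / (g * (g + h)).
Proof. by rewrite divr_gt0 // mulr_gt0. Qed.
Let W0 : 0 < W. Proof. exact: incomplete_beta_gt0. Qed.

(** Below [(r + v) / g] the first beta parameter is positive, hence the integral is finite; [W]
    undoes the normalisation in [m_mix]. *)
Lemma mixture_m_mix s v : s < (r + v) / g ->
  mixture r s v = (W * m_mix g h r s v)%:E.
Proof.
rewrite ltr_pdivlMr // mulrC => sv.
pose a := (r + v - g * s) / (g * (g + h)).
have a0 : 0 < a by rewrite divr_gt0 ?mulr_gt0 // subr_gt0.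
pose b := (r + v + h * s) / (h * (g + h)).
transitivity (\int[leb]_(q in `]0%R, x0])
   ((mix_const s v)%:E * (beta_density a b q)%:E))%E.
  apply: eq_integral => q; rewrite inE /= in_itv/= => /andP[q0 qx].
  by rewrite mix_densityE // (le_lt_trans qx).
rewrite ge0_integralZl_EFin //; last 3 first.
- by move=> q _; rewrite lee_fin beta_density_ge0.
- by apply/measurable_EFinP/measurable_funTS; exact: measurable_beta_density.
- exact/ltW/mix_const_gt0.
rewrite -EFin_incomplete_beta // -EFinM; congr (_%:E).
rewrite /m_mix -/(mix_const s v) -/x0 -/W -/a -/b.
by rewrite mulrCA; congr (_ * _); rewrite mulrCA divff ?mulr1 // gt_eqF.
Qed.

Lemma le_mixture s s' v : s <= s' -> (mixture r s v <= mixture r s' v)%E.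
Proof.
move=> ss'; apply: ge0_le_integral => //.
- by move=> q _; rewrite lee_fin mix_density_ge0.
- exact: mmd.
- exact: mmd.
- move=> q /=; rewrite in_itv/= => /andP[q0 qx].
  rewrite lee_fin /mix_density ler_wpM2l ?beta_density_ge0 // ler_expR lerD2r.
  by rewrite ler_wpM2l // tilt_ge0.
Qed.

(** At [s = (r + v) / g] the first beta parameter is 0 and the integral diverges; monotonicity
    covers larger [s]. *)
Lemma mixture_oo s v : (r + v) / g <= s -> mixture r s v = +oo%E.
Proof.
move=> sv; apply/eqP; rewrite -leye_eq; apply: le_trans (le_mixture v sv).
set s1 := (r + v) / g.
pose b := (r + v + h * s1) / (h * (g + h)).
rewrite /mixture; under eq_integral => q.
  rewrite inE /= in_itv/= => /andP[q0 qx].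
  rewrite mix_densityE // ?(le_lt_trans qx) //.
  rewrite (_ : r + v - g * s1 = 0); last by rewrite /s1 mulrC divfK ?subrr ?gt_eqF.
  rewrite mul0r EFinM.
  over.
rewrite ge0_integralZl_EFin //.
- by rewrite integral_beta0_oo // gt0_muley // lte_fin mix_const_gt0.
- by move=> q _; rewrite lee_fin beta_density_ge0.
- by apply/measurable_EFinP/measurable_funTS; exact: measurable_beta_density.
- exact/ltW/mix_const_gt0.
Qed.

Lemma mixture0_le v : 0 <= v -> (mixture r 0 v <= W%:E)%E.
Proof.
move=> v0; rewrite EFin_incomplete_beta //; apply: ge0_le_integral => //.
- by move=> q _; rewrite lee_fin mix_density_ge0.
- exact: mmd.
- by apply/measurable_EFinP/measurable_funTS; exact: measurable_beta_density.
- move=> q _; rewrite lee_fin /mix_density ler_piMr ?beta_density_ge0 // -expR0 ler_expR.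
  by rewrite mulr0 sub0r oppr_le0 mulr_ge0 // psi_bernoulli_ge0.
Qed.

Lemma mixture_convex t s s' v : 0 <= t <= 1 ->
  (mixture r ((1 - t) * s + t * s') v <=
   (1 - t)%:E * mixture r s v + t%:E * mixture r s' v)%E.
Proof.
move=> t01; have /andP[t0 t1] := t01.
have md0 s1 q : (0 <= (mix_density r s1 v q)%:E)%E.
  by rewrite lee_fin mix_density_ge0.
have t1' : 0 <= 1 - t by rewrite subr_ge0.
have mixtureZ k s1 : 0 <= k -> (k%:E * mixture r s1 v =
    \int[leb]_(q in `]0%R, x0]) (k%:E * (mix_density r s1 v q)%:E))%E.
  by move=> k0; rewrite ge0_integralZl_EFin //; exact: mmd.
have mmdZ k s1 : measurable_fun (`]0, x0] : set R)
    (fun q => k%:E * (mix_density r s1 v q)%:E)%E.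
  by apply: measurable_funeM; exact: mmd.
rewrite !mixtureZ // -ge0_integralD //; last 4 first.
- by move=> q _; rewrite mule_ge0.
- exact: mmdZ.
- by move=> q _; rewrite mule_ge0.
- exact: mmdZ.
apply: ge0_le_integral => //.
- exact: mmd.
- by apply: emeasurable_funD; exact: mmdZ.
- move=> q _; rewrite -!EFinM -EFinD lee_fin /mix_density.
  rewrite [(1 - t) * (_ * _)]mulrCA [t * (_ * _)]mulrCA -mulrDr.
  rewrite ler_wpM2l ?beta_density_ge0 //; apply: le_trans (expR_convex _ _ t01).
  by rewrite ler_expR le_eqVlt; apply/orP; left; apply/eqP; ring.
Qed.

(** This turns the crossing of a supremum into a threshold event for the mixture, attained value
    included. One direction is monotonicity. For the other, a mixture below the threshold at [s]
    stays below it slightly to the right, which convexity yields without a continuity argument. *)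
Lemma f_mix_leE l0 alpha s v : 0 <= v -> 1 < l0 / alpha ->
  (f_mix g h r l0 alpha v <= s) = ((l0 / alpha * W)%:E <= mixture r s v)%E.
Proof.
move=> v0; set K := l0 / alpha => K1.
pose A := [set s : R | [/\ 0 <= s, s < (r + v) / g & m_mix g h r s v < K]].
have rv0 : 0 < (r + v) / g by rewrite divr_gt0 // ltr_wpDr.
have A0 : A 0.
  split=> //; rewrite (le_lt_trans _ K1) // -(ler_pM2l W0) mulr1 -lee_fin.
  by rewrite -mixture_m_mix // mixture0_le.
have supA : has_sup A.
  by split; [exists 0|exists ((r + v) / g) => y [_ /ltW]].
have AE y : 0 <= y -> y < (r + v) / g -> A y <-> (mixture r y v < (K * W)%:E)%E.
  move=> y0 yv; rewrite mixture_m_mix // lte_fin mulrC ltr_pM2r //.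
  by split=> [[]|].
rewrite [f_mix _ _ _ _ _ _](_ : _ = sup A) //.
apply/idP/idP => [As|Ms]; last first.
  apply: ge_sup; first by exists 0.
  move=> y Ay; have [y0 yv _] := Ay; rewrite leNgt; apply/negP => /ltW sy.
  have := le_lt_trans (le_mixture v sy) ((AE y y0 yv).1 Ay).
  by rewrite ltNge Ms.
rewrite leNgt; apply/negP => Ms.
have s0 : 0 <= s by apply: le_trans As; apply: ub_le_sup => //; exact: supA.2.
have sv : s < (r + v) / g.
  by rewrite ltNge; apply/negP => /mixture_oo E; move: Ms; rewrite E.
(* The midpoint lies to the right of [s], where the mixture is still finite. *)
pose s1 := (s + (r + v) / g) / 2.
have ss1 : s < s1 by rewrite /s1; lra.
have s1v : s1 < (r + v) / g by rewrite /s1; lra.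
have := Ms; rewrite mixture_m_mix // lte_fin.
set m0 := W * _ => m0K.
pose m1 := W * m_mix g h r s1 v.
have m01 : m0 <= m1 by rewrite -lee_fin -!mixture_m_mix // le_mixture // ltW.
(* With gap [K * W - m0] and rise [m1 - m0], the weight gap / (gap + rise) makes [t] times the rise
   smaller than the gap, even for zero rise. *)
pose t := (K * W - m0) / (K * W - m0 + (m1 - m0)).
have den0 : 0 < K * W - m0 + (m1 - m0) by lra.
have t0 : 0 < t by rewrite divr_gt0 // subr_gt0.
have t1 : t <= 1 by rewrite ler_pdivrMr // mul1r lerDl subr_ge0.
have tm : t * (m1 - m0) < K * W - m0.
  rewrite /t mulrAC ltr_pdivrMr // ltr_pM2l ?subr_gt0 // ltrDr subr_gt0 //.
pose s' := (1 - t) * s + t * s1.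
have ss' : s < s' by rewrite /s'; nra.
have s's1 : s' <= s1 by rewrite /s'; nra.
have As' : A s'.
  apply/AE; [exact: le_trans (ltW ss')|exact: le_lt_trans s1v|].
  apply: le_lt_trans (mixture_convex _ _ _ _) _; first by rewrite ltW.
  rewrite !mixture_m_mix // -!EFinM -EFinD lte_fin -/m0 -/m1; lra.
have := ub_le_sup supA.2 As'; rewrite leNgt => /negP; apply.
exact: le_lt_trans As ss'.
Qed.

End bernoulli_mixture.

(** * The crossing probability of the mixture boundary *)

Theorem proposition8 (R : realType) (g h l0 alpha rho : R)
  (g_gt0 : 0 < g) (h_gt0 : 0 < h) (l0_ge1 : 1 <= l0)
  (alpha_gt0 : 0 < alpha) (alpha_lt1 : alpha < 1) (rho_gt : g * h < rho) :
  let r := rho - g * h in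
  sub_bernoulli_uniform_boundary g h l0 alpha (f_mix g h r l0 alpha).
Proof.
move=> r d T P F S V filtF [adS adV _ V0 subS] crossing.
have r0 : 0 < r by rewrite subr_gt0.
have l00 : 0 < l0 := lt_le_trans ltr01 l0_ge1.
have K1 : 1 < l0 / alpha by rewrite ltr_pdivlMr // mul1r (lt_le_trans alpha_lt1).
have gh0 : 0 < g + h by exact: addr_gt0.
pose x0 := h / (g + h).
have x0_gt0 : 0 < x0 by exact: divr_gt0.
have x0_lt1 : x0 < 1 by rewrite ltr_pdivrMr // mul1r ltrDr.
pose a := r / (g * (g + h)); pose b := r / (h * (g + h)).
have a0 : 0 < a by rewrite divr_gt0 // mulr_gt0.
pose W := incomplete_beta x0 a b.
have W0 : 0 < W by exact: incomplete_beta_gt0.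
pose M t w := mixture g h r (S t w) (V t w).
pose E t := [set w | (l0 / alpha * W)%:E <= M t w]%E.
(* Measurability with respect to [F t] itself is needed, since optional stopping requires [E t] to
   belong to [F t]. *)
have mM t : measurable_fun [set: g_sigma_algebraType (F t)] (M t).
  have mSV : measurable_fun [set: g_sigma_algebraType (F t)]
      (fun w => (S t w, V t w)).
    by apply: measurable_fun_pair; [exact: adS|exact: adV].
  exact: (measurableT_comp (measurable_mixture g h r) mSV).
have FE t : F t (E t).
  have [sF _] := filtF.1 t.
  have -> : E t = setT `&` M t @^-1` `[(l0 / alpha * W)%:E, +oo[.
    rewrite setTI; apply/seteqP; split=> w /=; rewrite in_itv/= andbT //.
  have := mM t measurableT _ (emeasurable_itv `[(l0 / alpha * W)%:E, +oo[).
  by rewrite /measurable /= sigma_algebra_id.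
have -> : crossing = \bigcup_t E t.+1.
  apply/seteqP; split=> w.
    by move=> [[|t]//= _]; rewrite f_mix_leE // => MK; exists t.
  by move=> [t _ /= MK]; exists t.+1 => //; rewrite f_mix_leE.
have mE t : measurable (E t) := filtration_measurable filtF (FE t).
split; first by apply: bigcup_measurable.
have mS t : measurable_fun setT (S t) := adapted_measurable filtF t adS.
have mV t : measurable_fun setT (V t) := adapted_measurable filtF t adV.
(* Markov's inequality will divide the expectation bound [l0 * W] by the threshold
   [l0 / alpha * W]. *)
have -> : alpha = l0 * W / (l0 / alpha * W).
  by field; rewrite !gt_eqF.
apply: (first_passage_prob filtF FE (M := M)).
- by rewrite !mulr_gt0 // invr_gt0.
- move=> t; have mSV := measurable_fun_pair (mS t) (mV t).
  exact: (measurableT_comp (measurable_mixture g h r) mSV).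
- by move=> t w; exact: mixture_ge0.
- by [].
move=> n.
(* The indicator lets [q] range over the whole line under Lebesgue measure. *)
pose I q : R := \1_(`]0, x0]%classic) q.
pose Z t (x : R * T) := mix_density g h r (S t x.2) (V t x.2) x.1 * I x.1.
have mI : measurable_fun setT I by exact: measurable_indic.
have ZE t w : M t w = (\int[lebesgue_measure]_q (Z t (q, w))%:E)%E.
  exact: mixture_indic.
under eq_bigr do under eq_integral do rewrite ZE.
have -> : (l0 * W)%:E =
    (\int[lebesgue_measure]_q (l0 * (beta_density a b q * I q))%:E)%E.
  rewrite EFinM EFin_incomplete_beta // integral_mkcond epatch_indic.
  under [RHS]eq_integral do rewrite EFinM.
  rewrite ge0_integralZl_EFin //.
  - by move=> q _; rewrite lee_fin mulr_ge0 ?beta_density_ge0.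
  - apply/measurable_EFinP/measurable_funM => //.
    exact: measurable_beta_density.
  - exact: ltW.
apply: (mixture_first_hit filtF FE) => //.
- move=> t; apply: measurable_funM; last exact: measurableT_comp.
  by apply: measurable_mix_density => //; exact: measurableT_comp.
- move=> t x; apply: mulr_ge0 => //; exact: mix_density_ge0.
- apply: measurable_funM => //; apply: measurable_funM => //.
  exact: measurable_beta_density.
(* Outside []0, x0]] both sides vanish; inside, the sub-Bernoulli condition is applied at
   [tilt g h q]. *)
move=> q; rewrite /Z /I /= indicE; have [|_] := boolP (q \in _); last first.
  rewrite !mulr0 big1 // => t _.
  by under eq_integral do rewrite mulr0; rewrite integral0.
rewrite inE /= in_itv/= => /andP[q0 qx].
have l_ge0 := tilt_ge0 g_gt0 h_gt0 q0 qx.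
have [L [sL L0 XL]] := subS _ l_ge0 (ltry _).
pose X t w := expR (tilt g h q * S t w - psi_bernoulli g h (tilt g h q) * V t w).
have mX t : measurable_fun setT (X t).
  apply: (measurableT_comp (@measurable_expR R)).
  by apply: measurable_funB; apply: measurable_funM.
have X0 t w : 0 <= X t w by exact: expR_ge0.
have H := dominated_first_hit filtF FE n sL mX X0 XL.
rewrite mulr1 [l0 * _]mulrC EFinM.
under eq_bigr do under eq_integral do rewrite mulr1 EFinM.
(* For fixed [q] the beta weight is a constant, so the claim reduces to optional stopping for the
   exponential factor. *)
have scale t : (\int[P]_(w in first_hit E t)
      ((beta_density a b q)%:E * (X t.+1 w)%:E) =
    (beta_density a b q)%:E * \int[P]_(w in first_hit E t) (X t.+1 w)%:E)%E.
  rewrite ge0_integralZl_EFin ?beta_density_ge0 //.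
  - exact: (measurable_first_hit filtF FE).
  - by move=> w _; rewrite lee_fin.
  - by apply/measurable_EFinP/measurable_funTS; exact: mX.
under eq_bigr do rewrite scale.
rewrite -ge0_sume_distrr; last first.
  by move=> t _; apply: integral_ge0 => w _; rewrite lee_fin.
rewrite lee_wpmul2l ?lee_fin ?beta_density_ge0 //.
by apply: le_trans H _; move: L0; rewrite unlock.
Qed.
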